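(* Let $m,n\geq 2$ be integers and let $\mathcal{C}_{m,n}=\operatorname{SPC}(m)\otimes\operatorname{SPC}(n)$. For every integer $r$ with $1\leq r\leq (m-1)(n-1)$, the $r$-th generalized Hamming weight of $\mathcal{C}_{m,n}$ is $$d_r(\mathcal{C}_{m,n})=r+1+\lambda_{m,n}(r),$$ where $$\lambda_{m,n}(r)=\min\left\{a+b:\ a,b\in\mathbb{Z},\ 1\leq a\leq m-1,\ 1\leq b\leq n-1,\ ab\geq r\right\}.$$ Equivalently, $$d_r(\mathcal{C}_{m,n})=r+1+\min_{\substack{1\leq a\leq m-1\\ 1\leq b\leq n-1\\ ab\geq r}}(a+b).$$
   Context: For $\ell\geq 2$, $\operatorname{SPC}(\ell)=\{\mathbf{x}\in\mathbb{F}_2^\ell:\sum_{i=1}^{\ell}x_i=0\}$ is the binary single parity-check code of length $\ell$ (all vectors of even Hamming weight). For binary linear codes $C_1,C_2$ with generator matrices $G_1,G_2$, the product code $C_1\otimes C_2$ is the linear code generated by the Kronecker product $G_1\otimes G_2$. Arranging coordinates row by row, $\mathcal{C}_{m,n}=\operatorname{SPC}(m)\otimes\operatorname{SPC}(n)$ is the $\mathbb{F}_2$-linear space of all $m\times n$ matrices over $\mathbb{F}_2$ in which every row and every column has even Hamming weight; it has length $mn$ and dimension $(m-1)(n-1)$. The support of a linear subcode $\mathcal{D}$ is the set of coordinate positions at which some codeword of $\mathcal{D}$ is nonzero. For a linear code $\mathcal{C}$ of dimension $k$ and $1\leq r\leq k$, the $r$-th generalized Hamming weight is $d_r(\mathcal{C})=\min\{|\operatorname{supp}(\mathcal{D})|:\mathcal{D}\text{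 a linear subcode of }\mathcal{C},\ \dim\mathcal{D}=r\}$. *)

(* Defs.v *)
From mathcomp Require Import all_boot all_algebra.
From mathcomp.real_closed Require Export mxtens.

Set Implicit Arguments.
Unset Strict Implicit.
Unset Printing Implicit Defensive.

Import GRing.Theory.
Local Open Scope ring_scope.

(* A binary linear code of length N is the row space of a matrix over 'F_2
   with N columns: its codewords are the v : 'rV_N with (v <= C)%MS, its
   subcodes are the D with (D <= C)%MS, and its dimension is \rank C. *)

Definition SPC (l : nat) : 'M['F_2]_l := kermx (const_mx 1 : 'cV['F_2]_l).

Lemma mem_SPC (l : nat) (x : 'rV['F_2]_l) :
  (x <= SPC l)%MS = (\sum_(i < l) x 0 i == 0).
Proof.
apply/sub_kermxP/eqP => [/matrixP/(_ 0 0)|h].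
  rewrite !mxE => h; apply: (etrans _ h).
  by apply: eq_bigr => i _; rewrite mxE mulr1.
apply/matrixP => i j; rewrite !ord1 !mxE; apply: (etrans _ h).
by apply: eq_bigr => k _; rewrite mxE mulr1.
Qed.

(* row_base C is a generator matrix of C with \rank C rows; by
   product_code_gen, any other choice of generators spans the same code.
   mxtens_index (i, j) = i * n2 + j numbers the coordinates row by row. *)
Definition product_code (k1 k2 n1 n2 : nat)
    (C1 : 'M['F_2]_(k1, n1)) (C2 : 'M['F_2]_(k2, n2)) :
    'M['F_2]_(\rank C1 * \rank C2, n1 * n2) :=
  row_base C1 *t row_base C2.

Lemma tensmxS (k1 k2 k1' k2' n1 n2 : nat)
    (A : 'M['F_2]_(k1, n1)) (B : 'M['F_2]_(k2, n2))
    (A' : 'M['F_2]_(k1', n1)) (B' : 'M['F_2]_(k2', n2)) :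
  (A <= A')%MS -> (B <= B')%MS -> (A *t B <= A' *t B')%MS.
Proof.
by move=> /submxP[X ->] /submxP[Y ->]; rewrite -tensmx_mul submxMl.
Qed.

Lemma product_code_gen (k1 k2 k1' k2' n1 n2 : nat)
    (C1 : 'M['F_2]_(k1, n1)) (C2 : 'M['F_2]_(k2, n2))
    (G1 : 'M['F_2]_(k1', n1)) (G2 : 'M['F_2]_(k2', n2)) :
  (G1 :=: C1)%MS -> (G2 :=: C2)%MS ->
  (product_code C1 C2 :=: G1 *t G2)%MS.
Proof.
move=> e1 e2; apply/eqmxP/andP; split; apply: tensmxS;
  by rewrite ?eq_row_base ?e1 ?e2.
Qed.

Definition Cmn (m n : nat) :
    'M['F_2]_(\rank (SPC m) * \rank (SPC n), m * n) :=
  product_code (SPC m) (SPC n).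

Lemma mem_Cmn (m n : nat) (v : 'rV['F_2]_(m * n)) :
  (v <= Cmn m n)%MS <->
  (forall i : 'I_m, \sum_(j < n) v 0 (mxtens_index (i, j)) = 0) /\
  (forall j : 'I_n, \sum_(i < m) v 0 (mxtens_index (i, j)) = 0).
Proof.
have eC : (Cmn m n :=: SPC m *t SPC n)%MS by apply: product_code_gen.
rewrite eC.
have ker1 l (k : 'I_l) : \sum_(i < l) SPC l k i = 0.
  have := mem_SPC (row k (SPC l)); rewrite row_sub => /esym/eqP h.
  by apply: (etrans _ h); apply: eq_bigr => i _; rewrite [RHS]mxE.
have sumE (w : 'I_(m * n) -> 'F_2) :
    \sum_k w k = \sum_(i < m) \sum_(j < n) w (mxtens_index (i, j)).
  rewrite pair_big (reindex (@mxtens_index m n)) /=.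
    by apply: eq_bigr => -[].
  by exists (@mxtens_unindex m n) => k _; rewrite (mxtens_indexK, mxtens_unindexK).
split=> [/submxP[w ->]|[hrow hcol]].
  split=> [i|j].
    under eq_bigr do rewrite mxE.
    rewrite exchange_big big1 //= => k _; rewrite -mulr_sumr.
    case: (mxtens_indexP k) => a b.
    under eq_bigr do rewrite tensmxE.
    by rewrite -mulr_sumr ker1 !mulr0.
  under eq_bigr do rewrite mxE.
  rewrite exchange_big big1 //= => k _; rewrite -mulr_sumr.
  case: (mxtens_indexP k) => a b.
  under eq_bigr do rewrite tensmxE.
  by rewrite -mulr_suml ker1 mul0r mulr0.
pose M : 'M['F_2]_(m, n) := \matrix_(i, j) v 0 (mxtens_index (i, j)).
have /submxP[X eX] : (M <= SPC n)%MS.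
  apply/row_subP => i; rewrite mem_SPC; apply/eqP; apply: (etrans _ (hrow i)).
  by apply: eq_bigr => j _; rewrite !mxE.
have /submxP[Y eY] : (M^T <= SPC m)%MS.
  apply/row_subP => j; rewrite mem_SPC; apply/eqP; apply: (etrans _ (hcol j)).
  by apply: eq_bigr => i _; rewrite !mxE.
pose Q := pinvmx (SPC n).
have eM : M = (SPC m)^T *m (Y^T *m Q) *m SPC n.
  rewrite [_ *m (Y^T *m Q)]mulmxA -trmx_mul -eY trmxK mulmxKpV //.
  by rewrite eX submxMl.
apply/submxP.
exists (\row_k (Y^T *m Q) (mxtens_unindex k).1 (mxtens_unindex k).2).
apply/rowP => k; case: (mxtens_indexP k) => i j.
have -> : v 0 (mxtens_index (i, j)) = M i j by rewrite mxE.
rewrite eM; move: (Y^T *m Q) => W.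
rewrite mxE [RHS]mxE sumE exchange_big; apply: eq_bigr => b _.
rewrite [X in X * _]mxE mulr_suml; apply: eq_bigr => a _.
rewrite tensmxE [(SPC m)^T _ _]mxE [X in _ = X * _]mxE mxtens_indexK /=.
by rewrite mulrA (mulrC (W a b)).
Qed.

Definition supp (k N : nat) (D : 'M['F_2]_(k, N)) : {set 'I_N} :=
  [set j | [exists v : 'rV['F_2]_N, (v <= D)%MS && (v 0 j != 0)]].

(* Every subcode is the row space of some square matrix D : 'M_N, so D ranges
   over all r-dimensional subcodes.  The unit N of the iterated minn bounds all
   support sizes: it only matters when there is no such D, i.e. r > \rank C. *)
Definition ghw (k N : nat) (C : 'M['F_2]_(k, N)) (r : nat) : nat :=
  \big[minn/N]_(D : 'M['F_2]_N | (D <= C)%MS && (\rank D == r)) #|supp D|.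

(* The unit m + n exceeds every a + b allowed; it only matters when no pair
   (a, b) is allowed, i.e. r > (m - 1) * (n - 1) or m or n is at most 1. *)
Definition lambda (m n r : nat) : nat :=
  \big[minn/(m + n)%N]_(p : 'I_m * 'I_n |
      [&& (1 <= p.1)%N, (1 <= p.2)%N & (r <= p.1 * p.2)%N]) (p.1 + p.2)%N.

Lemma bigminn_attained (I : finType) (P : pred I) (F : I -> nat) (u : nat) :
  (exists i, P i) -> (forall i, P i -> (F i <= u)%N) ->
  (exists2 i, P i & \big[minn/u]_(i | P i) F i = F i) /\
  (forall i, P i -> (\big[minn/u]_(i | P i) F i <= F i)%N).
Proof.
move=> [i0 Pi0] Fu; case: (arg_minnP F Pi0) => i Pi imin.
have le j : P j -> (\big[minn/u]_(i | P i) F i <= F j)%N.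
  move=> Pj; have : j \in index_enum I by rewrite mem_index_enum.
  elim: (index_enum I) => // k s IH; rewrite inE big_cons.
  case/predU1P => [<-|/IH le]; first by rewrite Pj geq_minl.
  by case: ifP => // _; rewrite geq_min le orbT.
split=> //; exists i => //; apply/eqP; rewrite eqn_leq le //=.
elim/big_ind: _ => [|x y hx hy|j Pj]; [exact: Fu | | exact: imin].
by rewrite leq_min hx.
Qed.

Lemma ghw_min (k N : nat) (C : 'M['F_2]_(k, N)) (r : nat) :
  (r <= \rank C)%N ->
  (exists D : 'M['F_2]_N,
     [/\ (D <= C)%MS, \rank D = r & #|supp D| = ghw C r]) /\
  (forall (l : nat) (D : 'M['F_2]_(l, N)),
     (D <= C)%MS -> \rank D = r -> (ghw C r <= #|supp D|)%N).
Proof.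
move=> rC.
pose P (D : 'M['F_2]_N) := (D <= C)%MS && (\rank D == r).
have exD : exists D, P D.
  pose D0 : 'M['F_2]_(\rank C) := pid_mx r.
  exists <<D0 *m row_base C>>%MS.
  rewrite /P !genmxE mxrankMfree ?row_base_free // rank_pid_mx // eqxx andbT.
  by rewrite (submx_trans (submxMl _ _)) ?eq_row_base.
have [|[D /andP[DC /eqP rD] eD] le] :=
    @bigminn_attained _ P (fun D => #|supp D|) N exD.
  by move=> D _; rewrite -[leqRHS]card_ord max_card.
split=> [|l E EC rE]; first by exists D.
have -> : supp E = supp <<E>>%MS.
  apply/setP => j; rewrite !inE; apply: eq_existsb => v.
  by rewrite genmxE.
by apply: le; rewrite /P !genmxE EC rE eqxx.
Qed.

Lemma lambda_min (m n r : nat) :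
  (2 <= m)%N -> (2 <= n)%N -> (r <= (m - 1) * (n - 1))%N ->
  (exists a b : nat, [/\ (1 <= a <= m - 1)%N, (1 <= b <= n - 1)%N,
     (r <= a * b)%N & lambda m n r = (a + b)%N]) /\
  (forall a b : nat, (1 <= a <= m - 1)%N -> (1 <= b <= n - 1)%N ->
     (r <= a * b)%N -> (lambda m n r <= a + b)%N).
Proof.
case: m => [|[|m]] //; case: n => [|[|n]] //; rewrite !subn1 /= => _ _ hr.
pose P (p : 'I_m.+2 * 'I_n.+2) :=
  [&& (1 <= p.1)%N, (1 <= p.2)%N & (r <= p.1 * p.2)%N].
have exP : exists p, P p by exists (ord_max, ord_max).
have [|[[a b] /and3P[/= a1 b1 ab] e] le] :=
    @bigminn_attained _ P (fun p => (p.1 + p.2)%N) (m.+2 + n.+2)%N exP.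
  by move=> [a b] _; rewrite leq_add // ltnW ?ltn_ord.
split; first by exists a, b; split=> //; rewrite ?a1 ?b1 -ltnS ltn_ord.
move=> x y /andP[x1 xm] /andP[y1 yn] xy.
have := le (Ordinal (xm : x < m.+2)%N, Ordinal (yn : y < n.+2)%N).
by apply; rewrite /P /= x1 y1.
Qed.

(* Main.v *)
Require Import Defs.
From mathcomp Require Import all_boot all_algebra.

(** For the lower bound let [D] be a subcode of dimension [r] and [b] the
    largest dimension of its projection on a row, attained at row [i0].  List
    the other rows and let [s_k] be the dimension lost when the words are
    required to vanish on the [k]-th row as well as on the preceding ones.
    Nothing is left at the end, because the column sums determine row [i0], so
    [r] is the sum of the [s_k <= b], hence [r <= a * b] where [a] is the number
    of nonzero [s_k].  Rows have even weight, so a row with [s_k > 0] meets the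
    support in at least [s_k + 1] positions, and row [i0] in at least [b + 1].
    Altogether the support has at least [r + a + b + 1] positions.

    For the upper bound, [r] of the words supported on the corners of a
    rectangle [{0, i} x {0, j}], with [1 <= i <= a] and [1 <= j <= b], span a
    subcode of dimension [r] whose support has at most [r + a + b + 1]
    positions. *)

Import GRing.Theory.
Local Open Scope ring_scope.

Lemma mem_supp (k N : nat) (D : 'M['F_2]_(k, N)) (j : 'I_N) :
  (j \in supp D) = [exists i, D i j != 0].
Proof.
rewrite inE; apply/existsP/existsP => [[v /andP[/submxP[w ->] wDj]]|[i Dij]].
  apply/existsP; apply: contraNT wDj; rewrite negb_exists => /forallP D0.
  rewrite mxE big1 // => i _.
  by move: (D0 i); rewrite negbK => /eqP ->; rewrite mulr0.
by exists (row i D); rewrite row_sub mxE.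
Qed.

Lemma suppP {k N : nat} (D : 'M['F_2]_(k, N)) (v : 'rV_N) (j : 'I_N) :
  (v <= D)%MS -> j \notin supp D -> v 0 j = 0.
Proof.
move=> vD; apply: contraNeq => vj; rewrite inE; apply/existsP.
by exists v; rewrite vD.
Qed.

Lemma suppS (k l N : nat) (D : 'M['F_2]_(k, N)) (E : 'M['F_2]_(l, N)) :
  (D <= E)%MS -> supp D \subset supp E.
Proof.
move=> DE; apply/subsetP => j; rewrite !inE => /existsP[v /andP[vD vj]].
by apply/existsP; exists v; rewrite (submx_trans vD DE).
Qed.

(** Right multiplication by [Q] restricts words to [T]; it is injective on the row space of [E] and
    has [#|T|] columns. *)
Lemma mxrank_le_card (F : fieldType) (k N : nat) (E : 'M[F]_(k, N))
    (T : {set 'I_N}) :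
  (forall v : 'rV_N, (v <= E)%MS -> (forall j, j \in T -> v 0 j = 0) -> v = 0) ->
  (\rank E <= #|T|)%N.
Proof.
move=> ET; pose Q : 'M[F]_(N, #|T|) := colsub enum_val 1%:M.
suff /mxrank_injP <- : (E :&: kermx Q)%MS == 0 by apply: rank_leq_col.
apply/rowV0P => v; rewrite sub_capmx => /andP[vE /sub_kermxP vQ].
apply: ET => // j jT; move/rowP/(_ (enum_rank_in jT j)): vQ.
by rewrite mulmx_colsub mulmx1 !mxE enum_rankK_in.
Qed.

(** Parity recovers the entry at one support position [j0] from the others, so restriction to the
    support minus [j0] is still injective. *)
Lemma mxrank_lt_supp (k n : nat) (E : 'M['F_2]_(k, n)) :
  (E <= SPC n)%MS -> (0 < \rank E)%N -> (\rank E < #|supp E|)%N.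
Proof.
move=> Eeven; have [E0|[j0 j0E]] := set_0Vmem (supp E).
  suff -> : E = 0 by rewrite mxrank0.
  apply/matrixP => h j; have := suppP E (row h E) j (row_sub h E).
  by rewrite E0 inE !mxE => ->.
rewrite (cardsD1 j0) j0E add1n ltnS => _.
apply: mxrank_le_card => v vE v0; apply/rowP => j; rewrite mxE.
have v0' i : i != j0 -> v 0 i = 0.
  move=> ij0; have [iE|] := boolP (i \in supp E); last exact: suppP vE.
  by apply: v0; rewrite in_setD1 ij0.
have [->|] := eqVneq j j0; last exact: v0'.
have := mem_SPC v; rewrite (submx_trans vE Eeven) (bigD1 j0) //=.
by rewrite big1 // addr0 => /esym/eqP.
Qed.

(** Induction on [s]: rank-nullity for [P i] splits [\rank D], and the kernel part [D1] goes to the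
    tail of [s]. *)
Lemma filtration_bound (I : eqType) (N n b : nat) (P : I -> 'M['F_2]_(N, n))
    (s : seq I) (k : nat) (D : 'M['F_2]_(k, N)) :
  (forall i, (D *m P i <= SPC n)%MS) ->
  (forall i, i \in s -> (\rank (D *m P i) <= b)%N) ->
  (forall v : 'rV_N, (v <= D)%MS -> (forall i, i \in s -> v *m P i = 0) ->
     v = 0) ->
  exists a, [/\ (a <= size s)%N, (\rank D <= a * b)%N &
    (\rank D + a <= \sum_(i <- s) #|supp (D *m P i)|)%N].
Proof.
elim: s k D => [|i s IHs] k D Deven Db Dinj.
  have -> : D = 0 by apply/row_matrixP => j; rewrite row0; apply: Dinj (row_sub j D) _.
  by exists 0%N; rewrite mxrank0.
pose D1 := (D :&: kermx (P i))%MS.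
have D1P j : (D1 *m P j <= D *m P j)%MS by rewrite submxMr ?capmxSl.
have [|j js|v|a [a_s rD1 sD1]] := IHs _ D1.
- by move=> j; apply: submx_trans (D1P j) (Deven j).
- by apply: leq_trans (mxrankS (D1P j)) (Db j _); rewrite inE js orbT.
- rewrite sub_capmx => /andP[vD /sub_kermxP vi] vs; apply: Dinj => // j.
  by rewrite inE => /predU1P[->|/vs].
have {sD1} sD : (\rank D1 + a <= \sum_(j <- s) #|supp (D *m P j)|)%N.
  by apply/(leq_trans sD1)/leq_sum => j _; rewrite subset_leq_card ?suppS.
rewrite big_cons; have := mxrank_mul_ker D (P i); rewrite -/D1 => <-.
have [Di0|Di_gt0] := posnP (\rank (D *m P i)).
  by exists a; rewrite Di0 add0n leqW // (leq_trans sD) ?leq_addl.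
(* A nonzero projection adds one to [a], paid for by the strict inequality of [mxrank_lt_supp]. *)
exists a.+1; split=> //; first by rewrite mulSn leq_add ?Db ?mem_head.
by rewrite addnS -!addSn -addnA leq_add ?mxrank_lt_supp.
Qed.

(** Taken as a matrix so that rank-nullity applies to restriction to a row. *)
Definition row_proj (m n : nat) (i : 'I_m) : 'M['F_2]_(m * n, n) :=
  colsub (fun j => mxtens_index (i, j)) 1%:M.

Lemma row_projE (m n k : nat) (D : 'M['F_2]_(k, m * n)) (i : 'I_m)
    (h : 'I_k) (j : 'I_n) :
  (D *m row_proj m n i) h j = D h (mxtens_index (i, j)).
Proof. by rewrite mulmx_colsub mulmx1 mxE. Qed.

Lemma card_supp_rows (m n k : nat) (D : 'M['F_2]_(k, m * n)) :
  #|supp D| = (\sum_(i < m) #|supp (D *m row_proj m n i)|)%N.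
Proof.
under eq_bigr do rewrite -sum1_card.
rewrite -sum1_card pair_big_dep (reindex (@mxtens_index m n)) /=.
  apply: eq_bigl => -[i j]; rewrite !mem_supp /=.
  by apply: eq_existsb => h; rewrite row_projE.
by exists (@mxtens_unindex m n) => x _; rewrite (mxtens_indexK, mxtens_unindexK).
Qed.

Lemma card_supp_ge (m n k : nat) (D : 'M['F_2]_(k, m * n)) :
  (D <= Cmn m n)%MS -> (0 < \rank D)%N ->
  exists a b, [/\ (1 <= a <= m - 1)%N, (1 <= b <= n - 1)%N,
    (\rank D <= a * b)%N & (\rank D + 1 + (a + b) <= #|supp D|)%N].
Proof.
move=> DC D_gt0; pose P := row_proj m n.
have CP v (vD : (v <= D)%MS) := (mem_Cmn v).1 (submx_trans vD DC).
have Deven i : (D *m P i <= SPC n)%MS.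
  apply/row_subP => h; rewrite row_mul mem_SPC; apply/eqP.
  rewrite -[RHS]((CP _ (row_sub h D)).1 i).
  by apply: eq_bigr => j _; rewrite row_projE.
have [i00 _] : exists i : 'I_m, true.
  case: m @P D DC D_gt0 {CP Deven} => [|m] P D _; last by exists ord0.
  by rewrite leqNgt ltnS (leq_trans (rank_leq_col D)).
have [i0 _ i0max] := arg_maxnP (fun i => \rank (D *m P i)) (erefl (xpredT i00)).
set b := \rank (D *m P i0) in i0max.
have [h _|v vD vs|a [a_m rD sD]] :=
    @filtration_bound _ _ _ b P (enum (predC1 i0)) _ D Deven.
- exact: i0max.
(* A word of [D] that vanishes off row [i0] vanishes there too, since each column sum reduces to one
   entry. *)
- apply/rowP => x; case: (mxtens_indexP x) => i j; rewrite [RHS]mxE.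
  have v0 i' : i' != i0 -> v 0 (mxtens_index (i', j)) = 0.
    by move=> ?; rewrite -row_projE vs ?mxE // mem_enum.
  have [->|/v0 //] := eqVneq i i0.
  by rewrite -((CP _ vD).2 j) (bigD1 i0) //= big1 ?addr0.
have b_gt0 : (0 < b)%N.
  by rewrite lt0n; apply: contraTneq rD => ->; rewrite muln0 -ltnNge.
have b_lt : (b < #|supp (D *m P i0)|)%N by apply: mxrank_lt_supp.
exists a, b; split=> //.
- rewrite subn1 -[m in m.-1]card_ord -(cardC1 i0) cardE a_m andbT lt0n.
  by apply: contraTneq rD => ->; rewrite -ltnNge.
- have b_n : (b < n)%N.
    by rewrite (leq_trans b_lt) // -[leqRHS]card_ord max_card.
  by rewrite b_gt0 subn1 -ltnS (ltn_predK b_n).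
- rewrite card_supp_rows (bigD1 i0) //= -big_enum addnACA addnC.
  by rewrite add1n leq_add.
Qed.

Lemma sum_indicator2 (n : nat) (c d : 'I_n) :
  \sum_(j < n) ((j == c)%:R + (j == d)%:R) = 0 :> 'F_2.
Proof.
have sum1 e : \sum_(j < n) (j == e)%:R = 1 :> 'F_2.
  by rewrite (bigD1 e) //= eqxx big1 ?addr0 // => j /negPf->.
by rewrite big_split /= !sum1; apply/eqP.
Qed.

Lemma exists_subcode (m n a b r : nat) :
  (1 <= a <= m - 1)%N -> (1 <= b <= n - 1)%N -> (r <= a * b)%N ->
  exists D : 'M['F_2]_(r, m * n),
    [/\ (D <= Cmn m n)%MS, \rank D = r & (#|supp D| <= r + 1 + (a + b))%N].
Proof.
case: m => [|m]; first by case: a.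
case: n => [|n]; first by case: b => // b _ /andP[].
rewrite !subn1 /= => /andP[_ a_m] /andP[b_gt0 b_n] r_ab.
(* Division by [b] numbers the cells of [[1, a] x [1, b]]; the shift by one keeps row 0 and column 0
   for the shared corners. *)
pose t (k : 'I_r) : 'I_m.+1 * 'I_n.+1 :=
  (inord (k %/ b).+1, inord (k %% b).+1).
have t1E k : (t k).1 = (k %/ b).+1 :> nat.
  by rewrite inordK // ltnS (leq_trans _ a_m) // ltn_divLR // (leq_trans _ r_ab).
have t2E k : (t k).2 = (k %% b).+1 :> nat.
  by rewrite inordK // ltnS (leq_trans _ b_n) // ltn_mod.
have t1_neq0 k : ((t k).1 == ord0) = false by rewrite -val_eqE /= t1E.
have t2_neq0 k : ((t k).2 == ord0) = false by rewrite -val_eqE /= t2E.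
have t_inj : injective t.
  move=> k l tkl; apply/val_inj; rewrite /= (divn_eq k b) (divn_eq l b).
  by congr (_ * _ + _)%N; apply: succn_inj; rewrite -?t1E -?t2E tkl.
pose G : 'M['F_2]_(r, m.+1 * n.+1) := \matrix_(k, x)
  let: (i, j) := mxtens_unindex x in
  ((i == ord0)%:R + (i == (t k).1)%:R) * ((j == ord0)%:R + (j == (t k).2)%:R).
have GE k i j : G k (mxtens_index (i, j)) =
    ((i == ord0)%:R + (i == (t k).1)%:R) * ((j == ord0)%:R + (j == (t k).2)%:R).
  by rewrite mxE mxtens_indexK.
exists G; split.
- apply/row_subP => k; apply/mem_Cmn; split=> [i|j].
    by under eq_bigr do rewrite mxE GE; rewrite -mulr_sumr sum_indicator2 mulr0.
  by under eq_bigr do rewrite mxE GE; rewrite -mulr_suml sum_indicator2 mul0r.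
(* The cell [t k] is a corner of the [k]-th rectangle only, so [G] restricted to these cells is the
   identity. *)
- pose Q : 'M['F_2]_(m.+1 * n.+1, r) := colsub (fun k => mxtens_index (t k)) 1%:M.
  have GQ : G *m Q = 1%:M.
    apply/matrixP => k l; rewrite mulmx_colsub mulmx1 !mxE mxtens_indexK.
    rewrite [t l]surjective_pairing t1_neq0 t2_neq0 !add0r -natrM mulnb.
    by rewrite -xpair_eqE -!surjective_pairing (inj_eq t_inj) eq_sym.
  apply/eqP; rewrite eqn_leq rank_leq_row -[X in (X <= _)%N](mxrank1 'F_2 r) -GQ.
  exact: mxrankM_maxl.
(* The support is covered by [a + 1] cells of column 0, including the common corner, [b] further
   cells of row 0, and the [r] cells [t k]. *)
pose A := [set mxtens_index (inord i : 'I_m.+1, ord0 : 'I_n.+1) | i : 'I_a.+1].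
pose B := [set mxtens_index (ord0 : 'I_m.+1, inord j.+1 : 'I_n.+1) | j : 'I_b].
pose T := [set mxtens_index (t k) | k : 'I_r].
have suppG : supp G \subset T :|: (A :|: B).
  apply/subsetP => x; case: (mxtens_indexP x) => i j.
  rewrite mem_supp => /existsP[k]; rewrite GE mulf_eq0 negb_or => /andP[ik jk].
  have {}ik : (i == ord0) || (i == (t k).1).
    by apply: contraNT ik; rewrite negb_or => /andP[/negPf-> /negPf->]; rewrite addr0.
  have {}jk : (j == ord0) || (j == (t k).2).
    by apply: contraNT jk; rewrite negb_or => /andP[/negPf-> /negPf->]; rewrite addr0.
  have i_a : (i < a.+1)%N.
    case/orP: ik => /eqP-> //.
    by rewrite t1E ltnS ltn_divLR // (leq_trans _ r_ab).
  rewrite !inE; case/orP: jk => [/eqP->|/eqP ej].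
    apply/orP; right; apply/orP; left; apply/imsetP; exists (Ordinal i_a) => //.
    by congr (mxtens_index (_, _)); apply/val_inj; rewrite /= inordK.
  case/orP: ik => /eqP ei.
    apply/orP; right; apply/orP; right; apply/imsetP.
    exists (Ordinal (ltn_pmod k b_gt0)) => //; rewrite ei ej.
    by congr (mxtens_index (_, _)).
  apply/orP; left; apply/imsetP; exists k => //.
  by rewrite ei ej -surjective_pairing.
apply: leq_trans (subset_leq_card suppG) _.
have cardI (p : nat) (f : 'I_p -> 'I_(m.+1 * n.+1)) : (#|f @: 'I_p| <= p)%N.
  by rewrite -[leqRHS]card_ord leq_imset_card.
rewrite -addnA (leq_trans (leq_card_setU _ _)) // leq_add ?cardI //.
by rewrite addnA add1n (leq_trans (leq_card_setU _ _)) // leq_add ?cardI.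
Qed.

Local Close Scope ring_scope.

Theorem theorem7 (m n : nat) (hm : 2 <= m) (hn : 2 <= n)
  (r : nat) (hr1 : 1 <= r) (hr : r <= (m - 1) * (n - 1)) :
  ghw (Cmn m n) r = r + 1 + lambda m n r.
Proof.
have [[a [b [ha hb r_ab lambdaE]]] lambda_le] := lambda_min hm hn hr.
have [D [DC rD suppD]] := exists_subcode m n a b r ha hb r_ab.
have [|[E [EC rE suppE]] ghw_le] := @ghw_min _ _ (Cmn m n) r.
  by rewrite -rD mxrankS.
apply/eqP; rewrite eqn_leq; apply/andP; split.
  by rewrite lambdaE; apply: leq_trans suppD; apply: ghw_le.
(* The pair obtained from an optimal subcode [E] is admissible in [lambda]. *)
have [|a' [b' [ha' hb']]] := card_supp_ge m n _ E EC; rewrite rE // suppE.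
by move=> r_ab'; apply: leq_trans; rewrite leq_add2l; apply: lambda_le.
Qed.
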